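(* Let $\tau>0$ and let $F\in C^0(\mathbb{R}\times\mathcal{C},\mathbb{R}^m)$ be weakly nonlinear with Lipschitz constant $K>0$, and assume $K\tau e<1$. Define $\widetilde F:\mathbb{R}\times\mathbb{R}^m\to\mathbb{R}^m$ by $\widetilde F(t,z)=F\big(t,[\bar y(t,z)]_t\big)$. Then $\widetilde F$ is continuous and, for every $(t_0,y_0)\in\mathbb{R}\times\mathbb{R}^m$, the initial value problem $z'(t)=\widetilde F(t,z(t))$, $z(t_0)=y_0$, is uniquely solved by the special solution $\bar y(t_0,y_0)$. Moreover, $\widetilde F$ is globally Lipschitz continuous in its second variable with Lipschitz constant $|\lambda_1|<Ke$, where $\lambda_1$ is the unique solution in $(-\frac1\tau,0)$ of $\lambda=-Ke^{-\lambda\tau}$.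
   Context: $\|\cdot\|_\infty$ is the max-norm on $\mathbb{R}^m$; $\mathcal{C}=C^0([-\tau,0],\mathbb{R}^m)$ with the sup-norm $\|u\|_\infty=\sup_{s\in[-\tau,0]}\|u(s)\|_\infty$; for $y$ defined on $[t-\tau,t]$, $y_t\in\mathcal{C}$, $y_t(s)=y(t+s)$. Consider the DDE $\frac{dy}{dt}=F(t,y_t)$. $F:\mathbb{R}\times\mathcal{C}\to\mathbb{R}^m$ is weakly nonlinear if it is continuous, there is $A\ge0$ with $\|F(t,0)\|_\infty\le A$ for all $t\in\mathbb{R}$, and there is $K>0$ with $\|F(t,u)-F(t,v)\|_\infty\le K\|u-v\|_\infty$ for all $t\in\mathbb{R}$, $u,v\in\mathcal{C}$. A special solution is a solution $\bar y:\mathbb{R}\to\mathbb{R}^m$ of the DDE defined (and satisfying the equation) on all of $\mathbb{R}$ with $\sup_{t\in\mathbb{R}}e^{-|t|/\tau}\|\bar y(t)\|<\infty$. It is known (Driver) that under weak nonlinearity and $K\tau e<1$, for every $(t_0,y_0)\in\mathbb{R}\times\mathbb{R}^m$ there is exactly one special solution with $\bar y(t_0)=y_0$; it is denoted $\bar y(t_0,y_0)$. *)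

(* Defs.v *)
(* R : realType, R^m = 'rV[R]_m whose canonical norm
   `|x| is the max-norm (mx_norm = max_i |x_i|). *)
From HB Require Import structures.
From mathcomp Require Import all_boot all_order all_algebra.
From mathcomp Require Import all_classical all_reals all_analysis.
From Stdlib Require Import ClassicalEpsilon.
Set Implicit Arguments. Unset Strict Implicit. Unset Printing Implicit Defensive.
Import Order.TTheory GRing.Theory Num.Theory.
Import numFieldNormedType.Exports.
Local Open Scope classical_set_scope.
Local Open Scope ring_scope.

Section DDE.
Variables (R : realType) (m : nat).
Notation V := 'rV[R]_m.

(* y_t, with y_t(s) = y(t+s); only its values on [-tau,0] are relevant *)
Definition seg (y : R -> V) (t : R) : R -> V := fun s => y (t + s).

(* u represents an element of C = C^0([-tau,0], R^m) *)
Definition inC (tau : R) (u : R -> V) : Prop := {within `[- tau, 0], continuous u}.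

Definition supn (tau : R) (u : R -> V) : R := sup [set `|u s| | s in `[- tau, 0]].

Definition fdiff (u v : R -> V) : R -> V := fun s => u s - v s.

Definition contRC (tau : R) (F : R -> (R -> V) -> V) : Prop :=
  forall t u, inC tau u -> forall e : R, 0 < e -> exists2 d : R, 0 < d &
    forall s v, inC tau v -> `|s - t| < d -> supn tau (fdiff v u) < d ->
      `|F s v - F t u| < e.

Definition weakly_nonlinear (tau K : R) (F : R -> (R -> V) -> V) : Prop :=
  [/\ contRC tau F,
      (exists2 A : R, 0 <= A & forall t, `|F t (fun _ => 0)| <= A) &
      (forall t u v, inC tau u -> inC tau v ->
         `|F t u - F t v| <= K * supn tau (fdiff u v))].

Definition special (tau : R) (F : R -> (R -> V) -> V) (y : R -> V) : Prop :=
  (forall t : R, is_derive t (1 : R) y (F t (seg y t))) /\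
  (exists M : R, forall t, expR (- `|t| / tau) * `|y t| <= M).

(* \bar y(t0,y0): the (by Driver, unique) special solution through (t0,y0) *)
Definition ybar (tau : R) (F : R -> (R -> V) -> V) (t0 : R) (y0 : V) : R -> V :=
  epsilon (inhabits (fun _ : R => (0 : V)))
          (fun y => special tau F y /\ y t0 = y0).

Definition Ftilde (tau : R) (F : R -> (R -> V) -> V) (t : R) (z : V) : V :=
  F t (seg (ybar tau F t z) t).

End DDE.

(* Main.v *)
(* Driver: weight functions on R by exp(-|t - t0|/tau).  A delay of at most tau
   costs a factor e and the integration gains a factor tau, so the Picard operator
   contracts with ratio K tau e < 1; this gives exactly one special solution through
   each (t0, y0), obtained here with antiderivatives and the mean value inequality.
   By uniqueness, special solutions solve z' = Ftilde(t, z).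

   Lipschitz constant: the weighted estimate gives |y - w|(t) <= |y - w|(t0) e
   within delay tau of t0, so K e works.  If L works, Gronwall's inequality for
   z' = Ftilde(t, z) bounds the difference of two special solutions over the delay
   interval by a factor exp(L tau), so K exp(L tau) works as well; iterating leads to
   the fixed point |lambda_1|.

   Continuity: along the special solution y through (t, z), Ftilde(s, y(s)) = F(s, y_s)
   is continuous in s, and the Lipschitz estimate controls Ftilde(s, z') - Ftilde(s, y(s)). *)
Require Import Defs.
From HB Require Import structures.
From mathcomp Require Import all_boot all_order all_algebra.
From mathcomp Require Import all_classical all_reals all_analysis.
From mathcomp Require Import ring lra.
Import Order.TTheory GRing.Theory Num.Theory.
Import numFieldNormedType.Exports.
Local Open Scope classical_set_scope.
Local Open Scope ring_scope.

Set Implicit Arguments.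
Unset Strict Implicit.
Unset Printing Implicit Defensive.

(** * Row vectors: max-norm and derivative by coordinates *)

Lemma rV_norm_le (R : realType) (m : nat) (x : 'rV[R]_m) (e : R) :
  0 <= e -> (forall i, `|x ord0 i| <= e) -> `|x| <= e.
Proof.
move=> e0 xe; rewrite [leLHS]/Num.Def.normr/= mx_normrE.
by apply: bigmax_le => // -[i j] _ /=; rewrite ord1.
Qed.

Lemma rV_coord_le_norm (R : realType) (m : nat) (x : 'rV[R]_m) i :
  `|x ord0 i| <= `|x|.
Proof.
by rewrite [leRHS]/Num.Def.normr/= mx_normrE (le_bigmax _ _ (ord0, i)).
Qed.

Lemma is_derive_coord (R : realType) (m : nat) (D : R -> 'rV[R]_m) (d : 'rV[R]_m)
    (t : R) i :
  is_derive t (1 : R) D d -> is_derive t (1 : R) (fun x => D x ord0 i) (d ord0 i).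
Proof.
move=> [Dt Dd]; split; first exact: (derivable_mxP (V := R^o) D t 1).1.
by have := derive_mx (V := R^o) Dt; rewrite Dd => ->; rewrite mxE.
Qed.

Lemma is_derive_rV (R : realType) (m : nat) (D : R -> 'rV[R]_m) (d : 'rV[R]_m)
    (t : R) :
  (forall i, is_derive t (1 : R) (fun x => D x ord0 i) (d ord0 i)) ->
  is_derive t (1 : R) D d.
Proof.
move=> H; have Dt : derivable D t 1.
  by apply/(derivable_mxP (V := R^o)) => i j; rewrite ord1; have [] := H j.
split => //; rewrite (derive_mx (V := R^o))//; apply/rowP => j.
by rewrite mxE; have [] := H j.
Qed.

Lemma is_derive_continuous (R : realType) (m : nat) (D : R -> 'rV[R]_m)
    (d : 'rV[R]_m) (t : R) :
  is_derive t (1 : R) D d -> {for t, continuous D}.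
Proof. by case=> /derivable1_diffP /differentiable_continuous. Qed.

(** * Mean value and Gronwall estimates *)

Lemma ler_dist_derive (R : realType) (g h dg dh : R -> R) (a b : R) : a <= b ->
  (forall x, a <= x <= b -> is_derive x (1 : R) g (dg x)) ->
  (forall x, a <= x <= b -> is_derive x (1 : R) h (dh x)) ->
  (forall x, a <= x <= b -> `|dg x| <= dh x) ->
  `|g b - g a| <= h b - h a.
Proof.
move=> ab Hg Hh le.
have mono (f df : R -> R) :
    (forall x, a <= x <= b -> is_derive x (1 : R) f (df x)) ->
    (forall x, a <= x <= b -> 0 <= df x) -> f a <= f b.
  move=> Hf Hp.
  have [||c] := @MVT_segment _ f df a b ab.
  - by move=> x /itvP xab; apply: Hf; rewrite !xab.
  - apply: derivable_within_continuous => x /itvP xab.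
    by have [] : is_derive x (1 : R) f (df x) by apply: Hf; rewrite !xab.
  - move=> /itvP cab /eqP; rewrite subr_eq => /eqP ->.
    by rewrite lerDr mulr_ge0 ?subr_ge0// Hp// !cab.
(* Since [|dg| <= dh], both [h - g] and [h + g] are nondecreasing, which bounds the increment of [g]
   from both sides. *)
have H1 : (h - g) a <= (h - g) b.
  apply: (mono _ (fun x => dh x - dg x)) => x xab.
    by have := Hh x xab; have := Hg x xab => ? ?; apply: is_deriveB.
  by have := le x xab; rewrite ler_norml; lra.
have H2 : (h + g) a <= (h + g) b.
  apply: (mono _ (fun x => dh x + dg x)) => x xab.
    by have := Hh x xab; have := Hg x xab => ? ?; apply: is_deriveD.
  by have := le x xab; rewrite ler_norml; lra.
move: H1 H2; rewrite /= ler_norml !fctE; lra.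
Qed.

Lemma rV_ler_dist_derive (R : realType) (m : nat) (g dg : R -> 'rV[R]_m)
    (h dh : R -> R) (a b : R) : a <= b ->
  (forall x, a <= x <= b -> is_derive x (1 : R) g (dg x)) ->
  (forall x, a <= x <= b -> is_derive x (1 : R) h (dh x)) ->
  (forall x, a <= x <= b -> `|dg x| <= dh x) ->
  `|g b - g a| <= h b - h a.
Proof.
move=> ab Hg Hh le; apply: rV_norm_le => [|i].
  (* As [m] may be 0, nonnegativity of the bound is shown separately, by the scalar estimate for the
     zero function. *)
  suff: `|(0 : R) - 0| <= h b - h a by rewrite subrr normr0.
  apply: (@ler_dist_derive _ (cst 0) h (cst 0) dh) => // x xab.
  by rewrite normr0; exact: le_trans (le x xab).
rewrite !mxE.
apply: (@ler_dist_derive _ (fun x => g x ord0 i) h (fun x => dg x ord0 i) dh) => //.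
  by move=> x xab; apply: is_derive_coord; exact: Hg.
by move=> x xab; apply: le_trans (le x xab); exact: rV_coord_le_norm.
Qed.

Lemma is_derive_expR_affine (R : realType) (k nu c t : R) :
  is_derive t (1 : R) (fun s => k * expR (nu * (s - c))) (k * nu * expR (nu * (t - c))).
Proof.
have H1 : is_derive t (1 : R) (fun s : R => nu * (s - c)) nu.
  have H : is_derive t (1 : R) (fun s : R => s - c) 1.
    exact: (is_derive_shift t 1 (- c)).
  by have := is_deriveZ nu H; rewrite /GRing.scale/= mulr1.
have H2 := @is_derive1_comp _ expR _ t _ _ (is_derive_expR (nu * (t - c))) H1.
have := is_deriveZ k H2; rewrite /GRing.scale/=.
by rewrite [expR _ * _]mulrC mulrA.
Qed.

(** On each side of [t0] the majorant is an exponential of an affine function, so the mean value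
    inequality applies there; on the left both [c] and [nu] change sign. *)
Lemma exp_growth (R : realType) (m : nat) (D dD : R -> 'rV[R]_m) (c nu t0 t : R) :
  0 < nu ->
  (forall s, Num.min t0 t <= s <= Num.max t0 t -> is_derive s (1 : R) D (dD s)) ->
  (forall s, Num.min t0 t <= s <= Num.max t0 t ->
     `|dD s| <= c * nu * expR (nu * `|s - t0|)) ->
  `|D t - D t0| <= c * (expR (nu * `|t - t0|) - 1).
Proof.
move=> nu0 HD Hle; have [tt|/ltW tt] := leP t0 t.
  rewrite ger0_norm ?subr_ge0// mulrBr mulr1.
  move: HD Hle; rewrite (min_idPl tt) (max_idPr tt) => HD Hle.
  have := @rV_ler_dist_derive _ _ D dD (fun s => c * expR (nu * (s - t0)))
    (fun s => c * nu * expR (nu * (s - t0))) t0 t tt HD.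
  rewrite subrr mulr0 expR0 mulr1; apply => s st.
    exact: is_derive_expR_affine.
  by apply: le_trans (Hle _ st) _; rewrite ger0_norm ?subr_ge0//; case/andP: st.
rewrite distrC ler0_norm ?subr_le0// mulrBr mulr1.
move: HD Hle; rewrite (min_idPr tt) (max_idPl tt) => HD Hle.
suff : `|D t0 - D t| <= - c * expR (- nu * (t0 - t0)) - - c * expR (- nu * (t - t0)).
  by rewrite subrr mulr0 expR0 mulrN [- nu * _]mulNr; lra.
apply: (@rV_ler_dist_derive _ _ D dD (fun s => - c * expR (- nu * (s - t0)))
  (fun s => - c * - nu * expR (- nu * (s - t0))) t t0 tt HD) => s st.
  exact: is_derive_expR_affine.
apply: le_trans (Hle _ st) _; rewrite ler0_norm ?subr_le0//; last by case/andP: st.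
by rewrite mulrNN mulrN mulNr.
Qed.

Lemma gronwall (R : realType) (m : nat) (D dD : R -> 'rV[R]_m) (L t0 t : R) :
  0 < L ->
  (forall s, Num.min t0 t <= s <= Num.max t0 t -> is_derive s (1 : R) D (dD s)) ->
  (forall s, Num.min t0 t <= s <= Num.max t0 t -> `|dD s| <= L * `|D s|) ->
  `|D t| <= `|D t0| * expR (L * `|t - t0|).
Proof.
move=> L0 HD Hle.
set a := Num.min t0 t; set b := Num.max t0 t.
have ab : a <= b by rewrite /a /b ge_min !le_max lexx.
(* At a maximum c of f, the mean value estimate reads f c e <= |D t0| + f c (e - 1)
   with e = exp(L |c - t0|), that is f c <= |D t0|. *)
pose f s := `|D s| * expR (- (L * `|s - t0|)).
have fc : {within `[a, b], continuous f}.
  apply/continuous_in_subspaceT => s; rewrite inE/= => /itvP sab.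
  apply: cvgM; first apply: cvg_norm.
    by apply: is_derive_continuous (HD s _); rewrite !sab.
  apply: continuous_comp; last exact: continuous_expR.
  apply: cvgN; apply: cvgMr; apply: cvg_norm.
  by apply: cvgB; [exact: cvg_id|exact: cvg_cst].
have [c /itvP cab maxc] := EVT_max ab fc.
have Df s : `|D s| = f s * expR (L * `|s - t0|).
  by rewrite /f -mulrA -expRD addNr expR0 mulr1.
have inab s : Num.min t0 c <= s <= Num.max t0 c -> a <= s <= b.
  have : a <= c <= b by rewrite !cab.
  rewrite /a /b; case: (leP t0 c) (leP t0 t) => ? [] ?; lra.
have h1 : `|D c - D t0| <= f c * (expR (L * `|c - t0|) - 1).
  apply: (@exp_growth _ _ _ dD) => // s /inab sab; first exact: HD.
  apply: le_trans (Hle s sab) _.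
  rewrite Df [f c * L]mulrC -(mulrA L (f c)) ler_pM2l// ler_wpM2r ?expR_ge0//.
  by apply: maxc; rewrite in_itv.
have h2 : `|D c| <= `|D t0| + `|D c - D t0| by rewrite -[in leLHS](subrK (D t0) (D c)) addrC ler_normD.
have h3 : f c <= `|D t0| by have := Df c; nra.
have tab : t \in `[a, b] by rewrite in_itv/= /a /b ge_min le_max !lexx !orbT.
by rewrite Df ler_wpM2r ?expR_ge0//; apply: le_trans h3; exact: maxc.
Qed.

(** Gronwall for the difference. Only times between [t0] and [t] enter, so solutions on a bounded
    interval are covered too. *)
Lemma lipschitz_ode_unique (R : realType) (m : nat) (L t0 t : R) (y z : R -> 'rV[R]_m)
    (G : R -> 'rV[R]_m -> 'rV[R]_m) : 0 < L ->
  (forall s u v, `|G s u - G s v| <= L * `|u - v|) ->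
  (forall s, Num.min t0 t <= s <= Num.max t0 t -> is_derive s (1 : R) y (G s (y s))) ->
  (forall s, Num.min t0 t <= s <= Num.max t0 t -> is_derive s (1 : R) z (G s (z s))) ->
  z t0 = y t0 -> z t = y t.
Proof.
move=> L0 lip Hy Hz zy; apply/eqP; rewrite -subr_eq0 -normr_le0.
have /le_trans : `|z t - y t| <= `|z t0 - y t0| * expR (L * `|t - t0|).
  apply: (@gronwall _ _ (z - y) (fun s => G s (z s) - G s (y s))) => // s st.
  exact: (is_deriveB (Hz s st) (Hy s st)).
by apply; rewrite zy subrr normr0 mul0r.
Qed.

(** * Antiderivatives of continuous functions on the whole line *)

Lemma continuous_antiderivative (R : realType) (G : R -> R) : continuous G ->
  exists Y : R -> R, forall t, is_derive t (1 : R) Y (G t).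
Proof.
move=> cG; pose P a x := \int[lebesgue_measure]_(t in `[a, x]) G t.
have HP (a x : R) : a < x -> is_derive x (1 : R) (P a) (G x).
  move=> ax; have x1 : x < x + 1 by rewrite ltrDl.
  have Gi : (@lebesgue_measure R).-integrable `[a, x + 1] (EFin \o G).
    apply: continuous_compact_integrable; first exact: segment_compact.
    exact: continuous_subspaceT.
  have [] := @continuous_FTC1 R G (BLeft a) x (x + 1) x1 Gi _ (cG x).
    by [].
  by move=> d dE; split; [exact: d|rewrite -derive1E; exact: dE].
(* [P a] is controlled only to the right of [a]. Two base points give the same derivative to the
   right of both, hence the same increments. *)
have indep (a a' x y : R) : a < x -> a < y -> a' < x -> a' < y -> x <= y ->
    P a x - P a y = P a' x - P a' y.
  move=> ax ay a'x a'y xy.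
  have : `|(P a - P a') y - (P a - P a') x| <= (0 : R) - 0.
    apply: (@ler_dist_derive _ _ (cst 0) (fun s => G s - G s) (cst 0)) => // s /andP[xs sy].
      have := HP a s (lt_le_trans ax xs); have := HP a' s (lt_le_trans a'x xs).
      by move=> ? ?; apply: is_deriveB.
    by rewrite subrr normr0.
  rewrite subrr normr_le0 !fctE => /eqP; lra.
(* The base point is moved left of both [x] and 0; subtracting the value at 0 makes the choice of
   base point immaterial. *)
pose Y x := P (Num.min x 0 - 1) x - P (Num.min x 0 - 1) 0.
have YE (a x : R) : a < x -> a < 0 -> Y x = P a x - P a 0.
  move=> ax a0; rewrite /Y; have m1 : Num.min x 0 - 1 < x.
    by have [] := leP x 0; lra.
  have m2 : Num.min x 0 - 1 < 0.
    by have [] := leP x 0; lra.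
  move: (Num.min x 0 - 1) m1 m2 => c m1 m2.
  have [x0|/ltW x0] := leP x 0; first exact: indep.
  by have := @indep c a 0 x m2 m1 a0 ax x0; lra.
exists Y => x; pose a := Num.min x 0 - 1.
have ax : a < x by rewrite /a; have [] := leP x 0; lra.
have a0 : a < 0 by rewrite /a; have [] := leP x 0; lra.
apply: (@near_eq_is_derive _ _ _ (P a - cst (P a 0))).
- near=> z; rewrite (@YE a)//.
  by near: z; exact: lt_nbhsr.
- rewrite -[G x]subr0; have := HP a x ax => ?; exact: is_deriveB.
Unshelve. all: by end_near. Qed.

Lemma rV_continuous_antiderivative (R : realType) (m : nat) (G : R -> 'rV[R]_m)
    (t0 : R) (y0 : 'rV[R]_m) : continuous G ->
  exists Y : R -> 'rV[R]_m, (forall t, is_derive t (1 : R) Y (G t)) /\ Y t0 = y0.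
Proof.
move=> cG.
have /choice[Y HY] (i : 'I_m) : exists Y : R -> R,
    forall t, is_derive t (1 : R) Y (G t ord0 i).
  apply: continuous_antiderivative => t.
  apply: (@continuous_comp _ _ _ G (fun x : 'rV[R]_m => x ord0 i)).
    exact: cG.
  exact: coord_continuous.
exists (fun t => \row_i (Y i t - Y i t0 + y0 ord0 i)); split => [t|].
  apply: is_derive_rV => i.
  under eq_fun do rewrite mxE -addrA.
  have := HY i t => ?.
  rewrite -[G t ord0 i]addr0.
  exact: (@is_deriveD _ _ _ (Y i) (cst _)).
by apply/rowP => i; rewrite mxE subrr add0r.
Qed.

(** * Segments in the sup-norm and geometric remainders *)

Lemma supn_le (R : realType) (m : nat) (tau c : R) (u : R -> 'rV[R]_m) : 0 < tau ->
  (forall s, - tau <= s <= 0 -> `|u s| <= c) -> supn tau u <= c.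
Proof.
move=> tau0 H; apply: ge_sup.
  by exists `|u 0|, 0 => //=; rewrite in_itv/= lexx oppr_le0 ltW.
by move=> _ [s /= /itvP st <-]; apply: H; rewrite !st.
Qed.

Lemma seg_inC (R : realType) (m : nat) (tau : R) (y : R -> 'rV[R]_m) (t : R) :
  continuous y -> inC tau (seg y t).
Proof.
move=> cy; apply: continuous_subspaceT => s.
apply: continuous_comp; last exact: cy.
by apply: cvgD; [exact: cvg_cst|exact: cvg_id].
Qed.

(** Continuity of the map sending [t] to [seg y t] in the sup-norm: compactness of [[-tau, 0]] makes
    the joint continuity in [(x, s)] uniform in [x]. *)
Lemma seg_near (R : realType) (m : nat) (tau : R) (y : R -> 'rV[R]_m) (t e : R) :
  continuous y -> 0 < e ->
  \forall s \near t, forall x, - tau <= x <= 0 -> `|y (s + x) - y (t + x)| <= e.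
Proof.
move=> cy e0.
have := (compact_near_coveringP _).1 (@segment_compact R (- tau) 0).
move=> /(_ R (nbhs t) (fun s x => `|y (s + x) - y (t + x)| <= e) _) H.
have : \forall s \near t, `[- tau, 0] `<=` (fun x => `|y (s + x) - y (t + x)| <= e).
  apply: H => x _.
  have c1 : (fun p : R * R => y (p.2 + p.1) - y (t + p.1)) @ (x, t) --> (0 : 'rV[R]_m).
    rewrite -(subrr (y (t + x))); apply: cvgB.
      apply: (@cvg_comp _ _ _ (fun p : R * R => p.2 + p.1) y _ (nbhs (t + x))).
        by apply: cvgD; [exact: cvg_snd|exact: cvg_fst].
      exact: cy.
    apply: (@cvg_comp _ _ _ (fun p : R * R => t + p.1) y _ (nbhs (t + x))).
      by apply: cvgD; [exact: cvg_cst|exact: cvg_fst].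
    exact: cy.
  have /cvgrPdist_le /(_ e e0) := c1.
  apply: filterS => -[a b] /=.
  by rewrite sub0r normrN.
by apply: filterS => s + x xt; apply; rewrite /= in_itv.
Qed.

Lemma geometric_small (R : realType) (q c e : R) : 0 <= q < 1 -> 0 < e ->
  exists n, q ^+ n * c <= e.
Proof.
move=> /andP[q0 q1] e0.
have /cvgr0Pnorm_le /(_ e e0) : geometric c q @ \oo --> (0 : R).
  by apply: cvg_geometric; rewrite ger0_norm.
move=> [n _ /(_ n (leqnn n))] /= h; exists n; rewrite mulrC.
exact: le_trans (ler_norm _) h.
Qed.

(** Lets the number of iterations tend to infinity in an estimate whose remainder shrinks by [q] at
    each step. *)
Lemma geometric_le (R : realType) (q a b c : R) : 0 <= q < 1 ->
  (forall n, a <= b + q ^+ n * c) -> a <= b.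
Proof.
move=> q01 H; apply/ler_addgt0Pr => e e0.
have [n hn] := @geometric_small _ q c e q01 e0.
by apply: le_trans (H n) _; rewrite lerD2l.
Qed.

(** * Weighted contraction and uniqueness of special solutions *)

Section SpecialSolutions.
Variables (R : realType) (m : nat) (tau K : R) (F : R -> (R -> 'rV[R]_m) -> 'rV[R]_m).
Hypotheses (tau_gt0 : 0 < tau) (K_gt0 : 0 < K) (wF : weakly_nonlinear tau K F)
  (q_lt1 : K * tau * expR 1 < 1).

(** [q] is the contraction ratio and [E t0 t] the reciprocal of the weight centred at [t0]: a bound
    [N * E t0 t] says that the weighted norm is at most [N]. *)
Local Notation q := (K * tau * expR 1).
Local Notation E t0 t := (expR (tau^-1 * `|t - t0|)).

Let q01 : 0 <= q < 1.
Proof.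
rewrite q_lt1 andbT mulr_ge0 ?expR_ge0// mulr_ge0//; exact: ltW.
Qed.

Let E_ge1 (t0 t : R) : 1 <= E t0 t.
Proof. by rewrite -expR0 ler_expR mulr_ge0// invr_ge0 ltW. Qed.

Lemma F_lipschitz_le (t c : R) (u v : R -> 'rV[R]_m) :
  inC tau u -> inC tau v ->
  (forall s, - tau <= s <= 0 -> `|u s - v s| <= c) -> `|F t u - F t v| <= K * c.
Proof.
move=> uC vC uv; have [_ _ lF] := wF.
apply: le_trans (lF t u v uC vC) _.
by rewrite ler_pM2l//; exact: supn_le.
Qed.

Lemma F_seg_continuous (y : R -> 'rV[R]_m) : continuous y ->
  continuous (fun t => F t (seg y t)).
Proof.
move=> cy t; have [cF _ _] := wF.
apply/cvgrPdist_lt => e e0.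
have [d d0 H] := cF t (seg y t) (@seg_inC R m tau y t cy) e e0.
have d2 : 0 < d / 2 by rewrite divr_gt0.
near=> s; rewrite distrC; apply: H.
- exact: seg_inC.
- rewrite distrC; near: s; exact: cvgr_dist_lt.
- apply: (@le_lt_trans _ _ (d / 2)); last by rewrite ltr_pdivrMr// mulr_natr mulr2n ltrDl.
  apply: supn_le => //; near: s; exact: seg_near.
Unshelve. all: by end_near. Qed.

Lemma weight_delay (t0 s x : R) : - tau <= x <= 0 ->
  E t0 (s + x) <= expR 1 * E t0 s.
Proof.
move=> /andP[x1 x2]; rewrite -expRD ler_expR.
have -> : 1 = tau^-1 * tau by rewrite mulVf ?gt_eqF.
rewrite -mulrDr ler_pM2l ?invr_gt0//.
have -> : s + x - t0 = x + (s - t0) by lra.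
apply: le_trans (ler_normD _ _) _; rewrite lerD2r ler_norml; lra.
Qed.

(** The delay gives e and integrating the weight gives [tau]. The [- 1], from integrating from [t0],
    lets [special_dist] keep the initial distance itself as constant. *)
Lemma picard_contraction (t0 c : R) (y w Y W : R -> 'rV[R]_m) :
  continuous y -> continuous w ->
  (forall t, is_derive t (1 : R) Y (F t (seg y t))) ->
  (forall t, is_derive t (1 : R) W (F t (seg w t))) ->
  (forall t, `|y t - w t| <= c * E t0 t) -> 0 <= c ->
  forall t, `|(Y t - W t) - (Y t0 - W t0)| <= q * c * (E t0 t - 1).
Proof.
move=> cy cw HY HW yw c0 t.
apply: (@exp_growth _ _ (Y - W) (fun s => F s (seg y s) - F s (seg w s))).
- by rewrite invr_gt0.
- move=> s _.
  have -> : q * c * tau^-1 * E t0 s = K * (c * (expR 1 * E t0 s)).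
    by rewrite /=; field; rewrite gt_eqF.
  apply: F_lipschitz_le; [exact: seg_inC|exact: seg_inC|move=> x xt].
  apply: le_trans (yw (s + x)) _.
  by rewrite ler_wpM2l//; exact: weight_delay.
Qed.

Lemma special_continuous (y : R -> 'rV[R]_m) : special tau F y -> continuous y.
Proof. by case=> Hy _ t; exact: is_derive_continuous (Hy t). Qed.

(** Moving the centre of the weight from 0 to [t0] costs only a constant factor, by the triangle
    inequality. *)
Lemma special_bound (t0 : R) (y : R -> 'rV[R]_m) : special tau F y ->
  exists2 N, 0 <= N & forall t, `|y t| <= N * E t0 t.
Proof.
move=> [_ [M HM]].
have M0 : 0 <= M by apply: le_trans (HM 0); rewrite mulr_ge0 ?expR_ge0.
exists (M * expR (tau^-1 * `|t0|)); first by rewrite mulr_ge0 ?expR_ge0.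
move=> t; apply: (@le_trans _ _ (M * expR (tau^-1 * `|t|))).
  have := HM t; rewrite -(ler_pM2l (expR_gt0 (tau^-1 * `|t|))) mulrA -expRD.
  by rewrite mulNr [`|t| / tau]mulrC addrN expR0 mul1r [leRHS]mulrC.
rewrite -mulrA ler_wpM2l// -expRD ler_expR -mulrDr ler_pM2l ?invr_gt0//.
by rewrite -[in leLHS](subrK t0 t) addrC ler_normD.
Qed.

Lemma special_dist (t0 t : R) (y w : R -> 'rV[R]_m) :
  special tau F y -> special tau F w ->
  `|y t - w t| <= `|y t0 - w t0| * E t0 t.
Proof.
move=> sy sw.
have [N1 N10 H1] := special_bound t0 sy; have [N2 N20 H2] := special_bound t0 sw.
set d := `|y t0 - w t0|; have d0 : 0 <= d by exact: normr_ge0.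
have /andP[q0 _] := q01.
(* Each contraction shrinks the a priori bound [N1 + N2] by [q], while the initial distance [d]
   stays. *)
have H n s : `|y s - w s| <= (d + q ^+ n * (N1 + N2)) * E t0 s.
  elim: n s => [|n IH] s.
    have := ler_normB (y s) (w s); have := H1 s; have := H2 s.
    by have := E_ge1 t0 s; rewrite expr0 mul1r; nra.
  have c0 : 0 <= d + q ^+ n * (N1 + N2) by rewrite addr_ge0// mulr_ge0 ?exprn_ge0 ?addr_ge0.
  have := picard_contraction (special_continuous sy) (special_continuous sw) sy.1 sw.1 IH c0 s.
  have : `|y s - w s| <= d + `|y s - w s - (y t0 - w t0)|.
    by rewrite -[in leLHS](subrK (y t0 - w t0) (y s - w s)) addrC ler_normD.
  have := E_ge1 t0 s; rewrite exprS; set e := E t0 s; set p := q ^+ n * _ => e1 h1 h2.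
  have -> : q * q ^+ n * (N1 + N2) = q * p by rewrite /p mulrA.
  apply: le_trans h1 _.
  apply: (@le_trans _ _ (d + q * (d + p) * (e - 1))); first by rewrite lerD2l.
  have p0 : 0 <= p by rewrite /p mulr_ge0 ?exprn_ge0 ?addr_ge0.
  (* This is [d + q * d * (e - 1) <= d * e], so the coefficient [d] does not grow. *)
  have : 0 <= (1 - q) * (d * (e - 1)).
    by rewrite mulr_ge0 ?subr_ge0 ?(ltW q_lt1)// mulr_ge0// subr_ge0.
  have : 0 <= q * p by rewrite mulr_ge0.
  by move: (q) => r; nra.
apply: (@geometric_le _ q _ _ ((N1 + N2) * E t0 t)) => // n.
by rewrite mulrA -mulrDl.
Qed.

Lemma special_eq (t0 : R) (y w : R -> 'rV[R]_m) :
  special tau F y -> special tau F w -> y t0 = w t0 -> y = w.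
Proof.
move=> sy sw yw; apply/funext => t; apply/eqP; rewrite -subr_eq0 -normr_le0.
by have := special_dist t0 t sy sw; rewrite yw subrr normr0 mul0r.
Qed.

(** * Existence of special solutions by Picard iteration *)

Lemma special_exists (t0 : R) (y0 : 'rV[R]_m) :
  exists y, special tau F y /\ y t0 = y0.
Proof.
have /andP[q0 _] := q01.
(* [T] is the Picard operator; its value at a discontinuous [y] is arbitrary. *)
have /choice[T HT] (y : R -> 'rV[R]_m) : exists Y : R -> 'rV[R]_m, continuous y ->
    (forall t, is_derive t (1 : R) Y (F t (seg y t))) /\ Y t0 = y0.
  have [cy|ncy] := pselect (continuous y); last by exists y.
  have [Y HY] := @rV_continuous_antiderivative R m _ t0 y0 (F_seg_continuous cy).
  by exists Y.
pose ys n := iter n T (fun=> y0).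
have cys n : continuous (ys n).
  elim: n => [|n IH]; first exact: cst_continuous.
  by move=> t; apply: is_derive_continuous ((HT _ IH).1 t).
have dys n t : is_derive t (1 : R) (ys n.+1) (F t (seg (ys n) t)).
  exact: (HT _ (cys n)).1.
have ys0 n : ys n t0 = y0 by case: n => // n; have [] := HT _ (cys n).
have [C C0 step] : exists2 C, 0 <= C & forall n t,
    `|ys n.+1 t - ys n t| <= C * q ^+ n * E t0 t.
  have [_ [A A0 HA] _] := wF.
  (* [A + K * |y0|] bounds [F] on the constant function [y0]; [tau] comes from integrating the
     weight. *)
  pose C := (A + K * `|y0|) * tau.
  have AK0 : 0 <= A + K * `|y0| by rewrite addr_ge0// mulr_ge0// ltW.
  have C0 : 0 <= C by rewrite mulr_ge0// ltW.
  exists C => //; elim=> [|n IH] t.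
    have : `|ys 1%N t - ys 1%N t0| <= C * (E t0 t - 1).
      apply: (@exp_growth _ _ (ys 1%N) (fun s => F s (seg (ys 0%N) s))).
      - by rewrite invr_gt0.
      - move=> s _; rewrite /C mulfK ?gt_eqF//.
        apply: (@le_trans _ _ (A + K * `|y0|)); last by have := E_ge1 t0 s; nra.
        have : `|F s (seg (ys 0%N) s) - F s (fun=> 0)| <= K * `|y0|.
          apply: F_lipschitz_le; first exact: seg_inC.
            by apply: continuous_subspaceT => x; exact: cst_continuous.
          by move=> x _; rewrite subr0.
        have := HA s; have := ler_normD (F s (seg (ys 0%N) s) - F s (fun=> 0)) (F s (fun=> 0)).
        rewrite subrK; lra.
    rewrite ys0 expr0 mulr1 => /le_trans; apply.
    by rewrite ler_wpM2l// gerBl.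
  have cq0 : 0 <= C * q ^+ n by rewrite mulr_ge0// exprn_ge0.
  have := picard_contraction (cys n.+1) (cys n) (dys n.+1) (dys n) IH cq0 t.
  rewrite !ys0 subrr subr0 => /le_trans; apply.
  rewrite exprS mulrCA ler_wpM2l//; last by rewrite gerBl.
  by rewrite mulr_ge0// mulr_ge0// exprn_ge0.
(* Sum of the geometric series of step bounds. *)
pose C' := C / (1 - q).
have q1 : 0 < 1 - q by rewrite subr_gt0.
have C'0 : 0 <= C' by rewrite divr_ge0// ltW.
have tele n k t : `|ys (n + k)%N t - ys n t| <= C' * q ^+ n * E t0 t.
  (* The induction on [k] closes with the exact finite geometric sum. *)
  suff : `|ys (n + k)%N t - ys n t| <= C' * (q ^+ n - q ^+ (n + k)) * E t0 t.
    move/le_trans; apply; rewrite ler_wpM2r ?expR_ge0// ler_wpM2l//.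
    by rewrite gerBl exprn_ge0.
  elim: k => [|k IH]; first by rewrite addn0 !subrr normr0 mulr0 mul0r.
  have := ler_normD (ys (n + k).+1 t - ys (n + k)%N t) (ys (n + k)%N t - ys n t).
  rewrite subrKA addnS => /le_trans; apply; have := step (n + k)%N t; move: IH.
  have CE : C = C' * (1 - q) by rewrite /C' divfK// gt_eqF.
  by rewrite [in X in _ -> X -> _]CE exprS; lra.
have cvys t : cvgn (fun n => ys n t).
  apply: cauchy_cvg; apply: cauchy_exP => e e0.
  have e2 : 0 < e / 2 by rewrite divr_gt0.
  have [N HN] := geometric_small (C' * E t0 t) q01 e2.
  exists (ys N t); exists N => // n /= Nn.
  rewrite -ball_normE /= distrC -(subnKC Nn); apply: le_lt_trans (tele _ _ _) _.
  by move: HN; rewrite mulrCA mulrA; lra.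
pose y t := limn (fun n => ys n t).
have ydist n t : `|y t - ys n t| <= C' * q ^+ n * E t0 t.
  apply/ler_addgt0Pr => e e0.
  have /cvgrPdist_le /(_ e e0) [k _ Hk] := cvys t.
  have := Hk (n + k)%N (leq_addl _ _); have := tele n k t.
  have := ler_normD (y t - ys (n + k)%N t) (ys (n + k)%N t - ys n t).
  by rewrite subrKA /=; lra.
(* The iterates converge uniformly near [t], because the weight is at most [E t0 t + 1] there. *)
have cy : continuous y.
  move=> t; apply/cvgrPdist_le => e e0.
  have e3 : 0 < e / 3 by rewrite divr_gt0.
  have [n Hn] := geometric_small (C' * (E t0 t + 1)) q01 e3.
  have Ec : {for t, continuous (fun s => E t0 s)}.
    apply: continuous_comp; last exact: continuous_expR.
    apply: cvgMr; apply: cvg_norm.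
    by apply: cvgB; [exact: cvg_id|exact: cvg_cst].
  have cq0 : 0 <= C' * q ^+ n by rewrite mulr_ge0// exprn_ge0.
  near=> s.
  have Es : E t0 s <= E t0 t + 1.
    have : `|E t0 t - E t0 s| <= 1.
      by near: s; move/cvgrPdist_le: Ec; apply.
    by rewrite ler_norml; lra.
  have h1 : `|ys n t - ys n s| <= e / 3.
    by near: s; have /cvgrPdist_le := @cys n t; apply.
  have h2 := ydist n t; have h3 := ydist n s.
  have h4 := ler_distD (ys n t) (y t) (y s).
  have h5 := ler_distD (ys n s) (ys n t) (y s).
  have h6 : `|ys n s - y s| <= C' * q ^+ n * (E t0 t + 1).
    by rewrite distrC; apply: le_trans h3 _; rewrite ler_wpM2l.
  have h7 : C' * q ^+ n * E t0 t <= C' * q ^+ n * (E t0 t + 1).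
    by rewrite ler_wpM2l// lerDl.
  have h8 : C' * q ^+ n * (E t0 t + 1) <= e / 3 by rewrite [C' * _]mulrC -(mulrA (q ^+ n)).
  by lra.
have [Y [dY Y0]] := @rV_continuous_antiderivative R m _ t0 y0 (F_seg_continuous cy).
(* The limit is a fixed point: [ys n.+1] is close to [Y] by contraction and to [y] by [ydist], both
   with errors of order [q ^+ n]. *)
have Yy : Y = y.
  apply/funext => t; apply/eqP; rewrite -subr_eq0 -normr_le0.
  apply: (@geometric_le _ q _ _ (2 * C' * E t0 t)) => // n.
  have cq0 : 0 <= C' * q ^+ n by rewrite mulr_ge0// exprn_ge0.
  have := picard_contraction cy (cys n) dY (dys n) (ydist n) cq0 t.
  rewrite Y0 ys0 subrr subr0 => h1; have h2 := ydist n.+1 t.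
  have := ler_distD (ys n.+1 t) (Y t) (y t); rewrite [`|ys n.+1 t - _|]distrC.
  move/le_trans; apply; rewrite add0r.
  have h3 : q * (C' * q ^+ n) * (E t0 t - 1) <= C' * q ^+ n * E t0 t.
    apply: ler_pM.
    - by rewrite mulr_ge0.
    - by rewrite subr_ge0.
    - by rewrite ler_piMl// ltW.
    - by rewrite gerBl.
  have h4 : C' * q ^+ n.+1 * E t0 t <= C' * q ^+ n * E t0 t.
    by rewrite ler_wpM2r ?expR_ge0// ler_wpM2l// exprS ler_piMl ?exprn_ge0// ltW.
  have -> : q ^+ n * (2 * C' * E t0 t) = C' * q ^+ n * E t0 t + C' * q ^+ n * E t0 t.
    by move: (q ^+ n) (E t0 t) => ? ?; ring.
  exact: lerD (le_trans h1 h3) (le_trans h2 h4).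
exists y; split; last by rewrite -Yy.
split; first by rewrite -Yy => t; rewrite [in F _ _]Yy.
(* [|y0| + C'] comes from comparing [y] with the iterate [ys 0]; the exponential recentres the
   weight at 0. *)
exists ((`|y0| + C') * expR (tau^-1 * `|t0|)) => t.
have h1 : `|y t| <= (`|y0| + C') * E t0 t.
  have := ydist 0%N t; rewrite expr0 mulr1 /= => h.
  have := ler_normD (y t - y0) y0; rewrite subrK => /le_trans; apply.
  by rewrite mulrDl addrC lerD// ler_peMr.
rewrite mulrC; apply: le_trans (ler_wpM2r (expR_ge0 _) h1) _.
rewrite -mulrA ler_wpM2l ?addr_ge0// -expRD ler_expR.
rewrite mulNr [`|t| / _]mulrC -mulrBr ler_pM2l ?invr_gt0// lerBlDr [leRHS]addrC.
exact: ler_normB.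
Unshelve. all: by end_near. Qed.

(** * From the delay equation to an ordinary differential equation *)

Lemma ybar_special (t0 : R) (y0 : 'rV[R]_m) :
  special tau F (ybar tau F t0 y0) /\ ybar tau F t0 y0 t0 = y0.
Proof. exact: (ClassicalEpsilon.epsilon_spec _ _ (special_exists t0 y0)). Qed.

(** By uniqueness, the special solution through any point of [y] is [y] itself; this removes the
    delay from the equation. *)
Lemma ybar_self (t : R) (y : R -> 'rV[R]_m) : special tau F y ->
  ybar tau F t (y t) = y.
Proof.
by move=> sy; have [? ?] := ybar_special t (y t); exact: (@special_eq t).
Qed.

Lemma Ftilde_special (t : R) (y : R -> 'rV[R]_m) : special tau F y ->
  Ftilde tau F t (y t) = F t (seg y t).
Proof. by move=> sy; rewrite /Ftilde ybar_self. Qed.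

Lemma is_derive_special (t : R) (y : R -> 'rV[R]_m) : special tau F y ->
  is_derive t (1 : R) y (Ftilde tau F t (y t)).
Proof. by move=> sy; rewrite Ftilde_special//; exact: sy.1. Qed.

(** * Lipschitz constants of [Ftilde] from the growth of distances over one delay *)

Lemma Ftilde_lipschitz_of_growth (t g : R) (z w : 'rV[R]_m) :
  (forall x, - tau <= x <= 0 ->
     `|ybar tau F t z (t + x) - ybar tau F t w (t + x)| <= g * `|z - w|) ->
  `|Ftilde tau F t z - Ftilde tau F t w| <= K * g * `|z - w|.
Proof.
move=> H; rewrite -mulrA.
have [sz _] := ybar_special t z; have [sw _] := ybar_special t w.
apply: F_lipschitz_le H; apply: seg_inC.
  exact: special_continuous sz.
exact: special_continuous sw.
Qed.

Lemma Ftilde_lipschitz0 (t : R) (z w : 'rV[R]_m) :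
  `|Ftilde tau F t z - Ftilde tau F t w| <= K * expR 1 * `|z - w|.
Proof.
apply: Ftilde_lipschitz_of_growth => x xt.
have [sz z0] := ybar_special t z; have [sw w0] := ybar_special t w.
have := special_dist t (t + x) sz sw; rewrite z0 w0 mulrC => /le_trans; apply.
rewrite ler_wpM2r//; have := weight_delay t t xt.
by rewrite subrr normr0 mulr0 expR0 mulr1.
Qed.

(** Improvement step: a known constant [L] replaces the growth factor e over one delay by
    [expR (L * tau)]. *)
Lemma Ftilde_lipschitzS (L : R) : 0 < L ->
  (forall t z w, `|Ftilde tau F t z - Ftilde tau F t w| <= L * `|z - w|) ->
  forall t z w,
    `|Ftilde tau F t z - Ftilde tau F t w| <= K * expR (L * tau) * `|z - w|.
Proof.
move=> L0 lip t z w; apply: Ftilde_lipschitz_of_growth => x xt.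
have [sz z0] := ybar_special t z; have [sw w0] := ybar_special t w.
set y := ybar tau F t z in sz z0 *; set v := ybar tau F t w in sw w0 *.
have /le_trans : `|y (t + x) - v (t + x)| <=
    `|y t - v t| * expR (L * `|t + x - t|).
  apply: (@gronwall _ _ (y - v)
    (fun s => Ftilde tau F s (y s) - Ftilde tau F s (v s))) => // s _.
  exact: (is_deriveB (is_derive_special s sz) (is_derive_special s sw)).
apply; rewrite z0 w0 mulrC ler_wpM2r// ler_expR ler_pM2l//.
by rewrite addrAC subrr add0r ler_norml; lra.
Qed.

(* The Lipschitz constants obtained by iterating L |-> K exp(L tau) from 1/tau
   decrease geometrically to the fixed point mu. *)
Lemma Ftilde_lipschitz (mu : R) : 0 < mu < tau^-1 -> mu = K * expR (mu * tau) ->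
  forall t z w, `|Ftilde tau F t z - Ftilde tau F t w| <= mu * `|z - w|.
Proof.
move=> /andP[mu0 mut] muE t z w.
have /andP[q0 q1] := q01.
(* [mu + c] is [1 / tau], which exceeds the starting constant [K e] because [q < 1]. *)
pose c := tau^-1 - mu; have c0 : 0 <= c by rewrite subr_ge0 ltW.
have tauV : tau^-1 * tau = 1 by rewrite mulVf ?gt_eqF.
have H n : forall s a b,
    `|Ftilde tau F s a - Ftilde tau F s b| <= (mu + q ^+ n * c) * `|a - b|.
  elim: n => [|n IH] s a b.
    apply: le_trans (Ftilde_lipschitz0 s a b) _; rewrite ler_wpM2r//.
    rewrite expr0 mul1r /c addrC subrK -(ler_pM2r tau_gt0) tauV mulrAC.
    exact: ltW.
  set L := mu + q ^+ n * c in IH.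
  have qc0 : 0 <= q ^+ n * c by rewrite mulr_ge0// exprn_ge0.
  have L0 : 0 < L by rewrite ltr_wpDr.
  (* This keeps the slope [K * tau * expR (L * tau)] of the iterated map at most [q]. *)
  have Lt : L * tau <= 1.
    rewrite -tauV ler_pM2r// /L; have : q ^+ n * c <= c.
      by rewrite ler_piMl// exprn_ile1// ltW.
    by rewrite /c; lra.
  apply: le_trans (Ftilde_lipschitzS L0 IH s a b) _; rewrite ler_wpM2r//.
  (* Tangent inequality for the exponential at [L * tau]. *)
  have h1 : expR (mu * tau) >= expR (L * tau) * (1 - (L - mu) * tau).
    have -> : mu * tau = L * tau + - ((L - mu) * tau) by ring.
    by rewrite expRD ler_wpM2l ?expR_ge0// expR_ge1Dx.
  have h2 : K * expR (L * tau) * ((L - mu) * tau) <= q ^+ n.+1 * c.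
    have -> : q ^+ n.+1 * c = K * expR 1 * ((L - mu) * tau).
      by rewrite exprS /L; move: (q ^+ n) => p; ring.
    have Lm : L - mu = q ^+ n * c by rewrite /L; ring.
    rewrite ler_wpM2r//; first by rewrite Lm mulr_ge0// ltW.
    by rewrite ler_pM2l// ler_expR.
  have h3 : K * (expR (L * tau) * (1 - (L - mu) * tau)) <= mu.
    by rewrite [leRHS]muE ler_pM2l.
  by move: h2 h3; move: (q ^+ n.+1 * c) (expR (L * tau)) => p e; lra.
apply: (@geometric_le _ q _ _ (c * `|z - w|)) => // n.
by rewrite mulrA -mulrDl.
Qed.

(** * Continuity of [Ftilde] *)

Lemma Ftilde_continuous (L : R) : 0 < L ->
  (forall t z w, `|Ftilde tau F t z - Ftilde tau F t w| <= L * `|z - w|) ->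
  continuous (fun p : R * 'rV[R]_m => Ftilde tau F p.1 p.2).
Proof.
move=> L0 lip [t z].
have [sy yt] := ybar_special t z; set y := ybar tau F t z in sy yt.
have cy := special_continuous sy.
apply/cvgrPdist_le => e e0.
have e2 : 0 < e / 2 by rewrite divr_gt0.
(* The last halving pays for comparing [y p.1] with [p.2] through [z]. *)
have eL : 0 < e / 2 / L / 2 by rewrite !divr_gt0.
near=> p => /=.
have h1 : `|F t (seg y t) - F p.1 (seg y p.1)| <= e / 2.
  near: p.
  have : (fun p : R * 'rV[R]_m => F p.1 (seg y p.1)) @ (t, z) --> F t (seg y t).
    apply: (@cvg_comp _ _ _ (@fst R 'rV[R]_m) (fun s => F s (seg y s)) _ (nbhs t)).
      exact: cvg_fst.
    exact: F_seg_continuous.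
  by move/cvgrPdist_le; apply.
have h2 : `|z - p.2| <= e / 2 / L / 2.
  near: p; have : (@snd R 'rV[R]_m) @ (t, z) --> z by exact: cvg_snd.
  by move/cvgrPdist_le; apply.
have h3 : `|z - y p.1| <= e / 2 / L / 2.
  near: p.
  have : (fun p : R * 'rV[R]_m => y p.1) @ (t, z) --> z.
    rewrite -[X in _ --> X]yt.
    apply: (@cvg_comp _ _ _ (@fst R 'rV[R]_m) y _ (nbhs t)); first exact: cvg_fst.
    exact: cy.
  by move/cvgrPdist_le; apply.
have h4 := lip p.1 (y p.1) p.2.
have h5 : `|y p.1 - p.2| <= e / 2 / L.
  by have := ler_distD z (y p.1) p.2; rewrite [`|y p.1 - z|]distrC; lra.
have h6 : L * `|y p.1 - p.2| <= e / 2.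
  have -> : e / 2 = L * (e / 2 / L) by rewrite [RHS]mulrC divfK// gt_eqF.
  by rewrite ler_pM2l.
have := ler_distD (Ftilde tau F p.1 (y p.1)) (Ftilde tau F t z) (Ftilde tau F p.1 p.2).
rewrite -[in Ftilde tau F t z]yt !Ftilde_special//; rewrite Ftilde_special// in h4.
lra.
Unshelve. all: by end_near. Qed.

(** * The characteristic equation, written for [mu = - lambda] *)

Lemma exp_fixpoint_exists : exists2 mu, 0 < mu < tau^-1 & mu = K * expR (mu * tau).
Proof.
have tauV : tau^-1 * tau = 1 by rewrite mulVf ?gt_eqF.
(* [f] is negative at 0 since [K > 0], and positive at [1 / tau] since [K tau e < 1]. *)
pose f (x : R) : R := x - K * expR (x * tau).
have fc : {within `[0, tau^-1], continuous f}.
  apply: continuous_subspaceT => x; apply: cvgB; first exact: cvg_id.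
  apply: cvgMr; apply: continuous_comp; last exact: continuous_expR.
  by apply: cvgMl; exact: cvg_id.
have t0 : 0 <= tau^-1 by rewrite invr_ge0 ltW.
have f0 : f 0 < 0 by rewrite /f mul0r expR0 mulr1 sub0r oppr_lt0.
have f1 : 0 < f tau^-1.
  by rewrite /f tauV subr_gt0 -(ltr_pM2r tau_gt0) tauV mulrAC.
have [|c] := @IVT _ f 0 tau^-1 0 t0 fc.
  by rewrite ge_min le_max (ltW f0) (ltW f1) orbT.
rewrite in_itv/= => /andP[c0 c1] fc0; exists c; last by move: fc0; rewrite /f; lra.
rewrite !lt_neqAle c0 c1 !andbT; apply/andP; split; apply/eqP => h.
  have f00 : f 0 = 0 by rewrite [in LHS]h.
  by move: f0; rewrite f00 ltxx.
by move: f1; rewrite -h fc0 ltxx.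
Qed.

(** At a fixed point [u] the map has slope [u * tau < 1] and lies above its tangent, so no fixed
    point lies below [u]; exchanging the roles gives equality. *)
Lemma exp_fixpoint_unique (a b : R) : a < tau^-1 -> b < tau^-1 ->
  a = K * expR (a * tau) -> b = K * expR (b * tau) -> a = b.
Proof.
have le_of (u v : R) : u < tau^-1 -> u = K * expR (u * tau) -> v = K * expR (v * tau) ->
    u <= v.
  move=> ut uE vE; rewrite leNgt; apply/negP => vu.
  have ut1 : u * tau < 1 by rewrite -ltr_pdivlMr// mul1r.
  have h : u * (1 - (u - v) * tau) <= v.
    rewrite [leRHS]vE {1}uE -mulrA ler_pM2l//.
    have -> : v * tau = u * tau + - ((u - v) * tau) by ring.
    by rewrite expRD ler_wpM2l ?expR_ge0// expR_ge1Dx.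
  have : 0 < (u - v) * (1 - u * tau) by rewrite mulr_gt0// subr_gt0.
  lra.
by move=> ? ? ? ?; apply/eqP; rewrite eq_le !le_of.
Qed.

End SpecialSolutions.

Unset Implicit Arguments.

Theorem mainTheorem6 (R : realType) (m : nat) (tau K : R)
    (F : R -> (R -> 'rV[R]_m) -> 'rV[R]_m) :
  0 < tau -> 0 < K -> weakly_nonlinear tau K F -> K * tau * expR 1 < 1 ->
  [/\ continuous (fun p : R * 'rV[R]_m => Ftilde tau F p.1 p.2),
      (forall (t0 : R) (y0 : 'rV[R]_m),
         (forall t, is_derive t (1 : R) (ybar tau F t0 y0)
                      (Ftilde tau F t (ybar tau F t0 y0 t))) /\
         ybar tau F t0 y0 t0 = y0 /\
         (forall (a b : R) (z : R -> 'rV[R]_m), a < t0 < b ->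
            (forall t, a < t < b -> is_derive t (1 : R) z (Ftilde tau F t (z t))) ->
            z t0 = y0 ->
            forall t, a < t < b -> z t = ybar tau F t0 y0 t)) &
      exists l1 : R,
        [/\ - tau^-1 < l1 < 0, l1 = - K * expR (- l1 * tau),
            (forall l : R, - tau^-1 < l < 0 -> l = - K * expR (- l * tau) -> l = l1),
            `|l1| < K * expR 1 &
            forall (t : R) (z w : 'rV[R]_m),
              `|Ftilde tau F t z - Ftilde tau F t w| <= `|l1| * `|z - w| ]].
Proof.
move=> tau_gt0 K_gt0 wF q_lt1.
have [mu mu01 muE] := exp_fixpoint_exists tau_gt0 K_gt0 q_lt1.
have /andP[mu_gt0 mu_lt] := mu01.
have lip := Ftilde_lipschitz tau_gt0 K_gt0 wF q_lt1 mu01 muE.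
split.
- exact: (Ftilde_continuous tau_gt0 K_gt0 wF q_lt1 mu_gt0 lip).
- move=> t0 y0; have [sy y0E] := ybar_special tau_gt0 K_gt0 wF q_lt1 t0 y0.
  have dy t := is_derive_special tau_gt0 K_gt0 wF q_lt1 t sy.
  split=> //; split=> // a b z /andP[at0 t0b] dz zt0 t /andP[a_t t_b].
  (* The times between [t0] and [t] stay inside the open interval where [z] solves the equation. *)
  apply: (lipschitz_ode_unique mu_gt0 lip (t0 := t0) (fun s _ => dy s)) => [s /andP[h1 h2]|].
  + apply: dz; apply/andP; split.
      by apply: lt_le_trans h1; rewrite lt_min at0.
    by apply: le_lt_trans h2 _; rewrite gt_max t0b.
  + by rewrite zt0 y0E.
- exists (- mu); split.
  + by rewrite ltrN2 mu_lt oppr_lt0.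
  + by rewrite opprK mulNr -muE.
  + move=> l /andP[l1 l2] lE; rewrite -[l]opprK; congr (- _).
    apply: (exp_fixpoint_unique tau_gt0 K_gt0) => //; first by rewrite ltrNl.
    by rewrite {1}lE mulNr opprK.
  (* Strictness comes from [mu * tau < 1]. *)
  + rewrite normrN gtr0_norm// muE ltr_pM2l// ltr_expR.
    by rewrite -ltr_pdivlMr// mul1r.
  + by move=> t z w; rewrite normrN gtr0_norm.
Qed.
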